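(* Let $\mathfrak{A}$ be a unital $C^*$-algebra, $a\in\mathfrak{A}$ a nonzero positive element, and let $x\in\mathfrak{A}_a$. Then $$v_a^4(x)\le\frac14 v_a^2(x^2)+\frac18 v_a\Big(x^2(xx^{\sharp_a}+x^{\sharp_a}x)+(xx^{\sharp_a}+x^{\sharp_a}x)x^2\Big)+\frac1{16}\Big\|(xx^{\sharp_a}+x^{\sharp_a}x)^2\Big\|_a.$$
   Context: $\mathcal{S}(\mathfrak{A})$ is the set of states of $\mathfrak{A}$ and $\mathcal{S}_a(\mathfrak{A})=\{f/f(a): f\in\mathcal{S}(\mathfrak{A}),\ f(a)\ne 0\}$. For $x\in\mathfrak{A}$, $\|x\|_a=\sup\{\sqrt{f(x^*ax)}: f\in\mathcal{S}_a(\mathfrak{A})\}\in[0,\infty]$, and the $a$-numerical radius is $v_a(x)=\sup\{|f(ax)|: f\in\mathcal{S}_a(\mathfrak{A})\}$; $v_a^k(x)$ means $(v_a(x))^k$. An element $x^{\sharp_a}\in\mathfrak{A}$ is an $a$-adjoint of $x$ if $ax^{\sharp_a}=x^*a$; $\mathfrak{A}_a$ is the set of all elements of $\mathfrak{A}$ admitting an $a$-adjoint (a subalgebra of $\mathfrak{A}$ on which $\|\cdot\|_a$ is a finite semi-norm). $a$-adjoints need not be unique; $x^{\sharp_a}$ denotes an $a$-adjoint of $x$, and the quantities in the claim do not depend on the choice. *)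

(* Defs.v *)
From HB Require Import structures.
From mathcomp Require Import all_boot all_order all_algebra.
From mathcomp Require Import complex.
From mathcomp Require Import all_classical all_reals ereal.

Set Implicit Arguments.
Unset Strict Implicit.
Unset Printing Implicit Defensive.

Import Order.TTheory GRing.Theory Num.Theory.
Import ComplexField.Normc.
Local Open Scope classical_set_scope.
Local Open Scope ring_scope.
Local Open Scope complex_scope.

(* Unital complex C*-algebras.  The norm and its completeness are fields of the
   structure: MathComp's normed modules cannot be joined with [algType], because
   [numDomainType] already is the only join of rings and normed Z-modules and
   forces the norm to take its values in the ring itself. *)
HB.mixin Record Algebra_isCStarAlgebra (R : realType) A
    of GRing.Algebra R[i] A := {
  star : A -> A;
  starK : involutive star;
  starD : forall x y : A, star (x + y) = star x + star y;
  starZ : forall (c : R[i]) (x : A), star (c *: x) = c^*%C *: star x;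
  starM : forall x y : A, star (x * y) = star y * star x;
  cnorm : A -> R;
  cnorm_eq0 : forall x : A, cnorm x = 0 -> x = 0;
  cnormD : forall x y : A, cnorm (x + y) <= cnorm x + cnorm y;
  cnormZ : forall (c : R[i]) (x : A), cnorm (c *: x) = normc c * cnorm x;
  cnormM : forall x y : A, cnorm (x * y) <= cnorm x * cnorm y;
  cnorm_star : forall x : A, cnorm (star x * x) = cnorm x ^+ 2;
  cnorm_complete : forall u : nat -> A,
    (forall e : R, 0 < e -> exists N : nat, forall m n : nat,
        (N <= m)%N -> (N <= n)%N -> cnorm (u m - u n) < e) ->
    exists l : A, forall e : R, 0 < e -> exists N : nat, forall n : nat,
        (N <= n)%N -> cnorm (u n - l) < e
}.

#[short(type="cstarAlgType")]
HB.structure Definition CStarAlgebra (R : realType) :=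
  { A of GRing.Algebra R[i] A & Algebra_isCStarAlgebra R A }.

Definition positive (R : realType) (A : cstarAlgType R) (a : A) : Prop :=
  exists b : A, a = star b * b.

Definition functional_norm (R : realType) (A : cstarAlgType R)
    (f : A -> R[i]) : \bar R :=
  ereal_sup [set (normc (f x))%:E | x in [set x : A | cnorm x <= 1]].

(* [0 <= z] in R[i] means that z is real and nonnegative. *)
Definition states (R : realType) (A : cstarAlgType R) : set {scalar A} :=
  [set f | (forall x : A, positive x -> 0 <= f x) /\ functional_norm f = 1%E].

Definition a_states (R : realType) (A : cstarAlgType R) (a : A) :
    set (A -> R[i]) :=
  [set (fun x => f x / f a) | f in [set f | states f /\ f a != 0]].

(* Supremum in [0, +oo]: 0 is adjoined so that the supremum of the empty set is
   0 rather than -oo. *)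
Definition nnsup (R : realType) (E : set \bar R) : \bar R :=
  ereal_sup (0%E |` E).

(* [g (star x * a * x)] is real and nonnegative for g in [a_states a] and
   positive a, so that [complex.Re] only changes its type. *)
Definition a_norm (R : realType) (A : cstarAlgType R) (a x : A) : \bar R :=
  nnsup [set (Num.sqrt (complex.Re (g (star x * a * x))))%:E | g in a_states a].

Definition a_numerical_radius (R : realType) (A : cstarAlgType R) (a x : A) :
    \bar R :=
  nnsup [set (normc (g (a * x)))%:E | g in a_states a].

Definition is_a_adjoint (R : realType) (A : cstarAlgType R) (a x y : A) : Prop :=
  a * y = star x * a.

(* Main.v *)
(** For an a-state [g], rotate [x] by a phase so that [g (a x) >= 0] and put
    [h = x + xs], which is symmetric for the semi-inner product
    [<y, z> = g (z* a y)], with [<1, 1> = 1].  Cauchy-Schwarz applied twice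
    gives [(2 g (a x))^4 <= g (a h^4)], and [h^2 = w + s] with
    [w = x^2 + xs^2].  Expanding [h^4 = w^2 + (w s + s w) + s^2], the last two
    terms are bounded directly, while [g (a w^2) = <w, w>] is at most the
    square of the numerical radius of [w] because [w] is a-self-adjoint.  That
    bound comes from polarization: up to normalization, the functionals
    [z |-> g (y* z y)] are again a-states. *)

Require Import Defs.
From HB Require Import structures.
From mathcomp Require Import all_boot all_order all_algebra.
From mathcomp Require Import complex.
From mathcomp Require Import all_classical all_reals ereal.
From mathcomp Require Import ring lra.

Set Implicit Arguments.
Unset Strict Implicit.
Unset Printing Implicit Defensive.

Import Order.TTheory GRing.Theory Num.Theory.
Import ComplexField.Normc.
Local Open Scope ring_scope.

(** States are bundled linear forms, so rescaled or compressed functionals, first written as plain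
    functions, must be bundled again. *)
Lemma scalar_witness (R : realType) (A : cstarAlgType R) (F : A -> R[i]) :
  scalar F -> exists f : {scalar A}, f = F :> (A -> R[i]).
Proof.
move=> linF; pose B := GRing.isLinear.Build _ _ _ _ F linF.
by pose f : {scalar A} := HB.pack F B; exists f.
Qed.

(** * Elementary facts on the involution, the norm and the complex modulus *)

Lemma starN (R : realType) (A : cstarAlgType R) (x : A) : star (- x) = - star x.
Proof. by rewrite -scaleN1r starZ rmorphN1 scaleN1r. Qed.

Lemma star1 (R : realType) (A : cstarAlgType R) : star (1 : A) = 1.
Proof. by rewrite -[LHS]mulr1 -{2}[1 in LHS]starK -starM mulr1 starK. Qed.

Lemma cnorm0 (R : realType) (A : cstarAlgType R) : cnorm (0 : A) = 0.
Proof. by rewrite -(scale0r (0 : A)) cnormZ normc0 mul0r. Qed.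

Lemma cnorm_ge0 (R : realType) (A : cstarAlgType R) (x : A) : 0 <= cnorm x.
Proof.
have := cnormD x (- x); rewrite subrr cnorm0 -scaleN1r cnormZ normcN normc1.
by lra.
Qed.

Lemma normcJ (R : rcfType) (z : R[i]) : normc z^*%C = normc z.
Proof. by case: z => u v /=; rewrite sqrrN. Qed.

Lemma normc_sqr (R : rcfType) (z : R[i]) :
  normc z ^+ 2 = complex.Re z ^+ 2 + complex.Im z ^+ 2.
Proof. by case: z => u v /=; rewrite sqr_sqrtr // addr_ge0 ?sqr_ge0. Qed.

Lemma normc_ge0 (R : rcfType) (z : R[i]) : 0 <= normc z.
Proof. by case: z => u v /=; rewrite sqrtr_ge0. Qed.

Lemma norm_Re_le (R : rcfType) (z : R[i]) : `|complex.Re z| <= normc z.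
Proof.
rewrite -ler_sqr ?nnegrE ?normc_ge0 // normc_sqr real_normK ?num_real //.
by rewrite lerDl sqr_ge0.
Qed.

(** * Positive functionals *)

Definition positive_functional (R : realType) (A : cstarAlgType R)
  (f : A -> R[i]) := forall x : A, positive x -> 0 <= f x.

Lemma positive_sandwich (R : realType) (A : cstarAlgType R) (a y : A) :
  positive a -> positive (star y * a * y).
Proof. by case=> b ->; exists (b * y); rewrite starM !mulrA. Qed.

Lemma positive_star (R : realType) (A : cstarAlgType R) (a : A) :
  positive a -> star a = a.
Proof. by case=> b ->; rewrite starM starK. Qed.

(** Positivity at [star y * y] for [y = 1 + c *: z] forces the cross terms to have a real sum;
    [c = 1] and [c = 'i] then compare imaginary and real parts. *)
Lemma functional_star (R : realType) (A : cstarAlgType R) (f : {scalar A})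
    (z : A) : positive_functional f -> f (star z) = (f z)^*%C.
Proof.
move=> f_pos.
have key (c : R[i]) :
    complex.Im (c^*%C * f (star z) + c * f z) = 0.
  have pos (y : A) : complex.Im (f (star y * y)) = 0.
    by apply/ger0_Im/f_pos; exists y.
  have := pos (1 + c *: z); rewrite starD starZ star1.
  rewrite mulrDl mul1r mulrDr mulr1 -scalerAr -!scalerAl scalerA.
  rewrite !linearD /= !scalarZ /=.
  have := pos z; have := pos 1; rewrite star1 mulr1.
  case: (f 1) (f z) (f (star z)) (f (star z * z)) c {pos f_pos} =>
    [u1 v1] [u2 v2] [u3 v3] [u4 v4] [c1 c2] /= -> ->.
  by lra.
have := key 1; have := key 'i%C.
case: (f z) (f (star z)) => [u v] [u' v'] /= ? ?.
by apply/eqP; rewrite eq_complex /=; apply/andP; split; apply/eqP; lra.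
Qed.

Lemma normc_real (R : rcfType) (r : R) : 0 <= r -> normc r%:C%C = r.
Proof. by move=> r0; rewrite /= expr0n addr0 sqrtr_sqr ger0_norm. Qed.

(** * Bounded functionals and their normalization to a-states *)

Lemma functional_norm_leP (R : realType) (A : cstarAlgType R) (f : A -> R[i])
    (c : R) : (functional_norm f <= c%:E)%E <->
  forall x : A, cnorm x <= 1 -> normc (f x) <= c.
Proof.
split=> [/ereal_supP fc x x1|fc].
  by rewrite -lee_fin; apply: fc; exists x.
by apply: ge_ereal_sup => _ [x x1 <-]; rewrite lee_fin fc.
Qed.

Lemma functional_norm_ge0 (R : realType) (A : cstarAlgType R) (f : A -> R[i]) :
  (0 <= functional_norm f)%E.
Proof.
apply: le_ereal_sup_tmp; exists (normc (f 0))%:E;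
  last by rewrite lee_fin normc_ge0.
by exists 0 => //=; rewrite cnorm0.
Qed.

Lemma normc_functional_le (R : realType) (A : cstarAlgType R) (f : {scalar A})
    (c : R) (x : A) :
  (functional_norm f <= c%:E)%E -> normc (f x) <= c * cnorm x.
Proof.
move=> /functional_norm_leP fc.
have [x0|x_neq0] := eqVneq (cnorm x) 0.
  by rewrite x0 mulr0 (cnorm_eq0 _ x0) linear0 normc0.
have x_gt0 : 0 < cnorm x by rewrite lt0r x_neq0 cnorm_ge0.
have V_ge0 : 0 <= (cnorm x)^-1 by rewrite invr_ge0 cnorm_ge0.
have := fc (((cnorm x)^-1)%:C%C *: x).
rewrite cnormZ scalarZ normcM normc_real // mulVf // => /(_ (lexx _)).
by rewrite ler_pdivrMl // mulrC.
Qed.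

(** With [r] the norm of [f], the functional [f / r] is a state, and the quotient by the value at
    [a] does not see the factor [r]. *)
Lemma a_states_normalize (R : realType) (A : cstarAlgType R) (a : A)
    (f : {scalar A}) (c : R) :
  positive_functional f -> (functional_norm f <= c%:E)%E -> f a != 0 ->
  a_states a (fun x => f x / f a).
Proof.
move=> f_pos f_le fa_neq0.
have [r fE] : exists r, functional_norm f = r%:E.
  have := functional_norm_ge0 f; case: (functional_norm f) f_le => // r _ _.
  by exists r.
have f_ler : (functional_norm f <= r%:E)%E by rewrite fE.
have r_gt0 : 0 < r.
  have := normc_functional_le a f_ler.
  have : 0 < normc (f a).
    by rewrite lt0r normc_ge0 andbT; apply: contra fa_neq0 => /eqP/eq0_normc/eqP.
  move=> /lt_le_trans h /h; rewrite pmulr_lgt0 //.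
  rewrite lt0r cnorm_ge0 andbT; apply: contra fa_neq0 => /eqP/cnorm_eq0 ->.
  by rewrite linear0.
have V_ge0 : 0 <= r^-1 by rewrite invr_ge0 ltW.
pose F x := (r^-1)%:C%C * f x.
have [G GE] : exists G : {scalar A}, G = F :> (A -> R[i]).
  by apply: scalar_witness => k u v; rewrite /F linearP /= mulrDr mulrCA.
have r_neq0 : (r^-1)%:C%C != 0 :> R[i].
  by rewrite eq_complex /= eqxx andbT invr_eq0 gt_eqF.
exists G => /=; last first.
  by apply/funext => x; rewrite GE /F invfM mulrACA divff // mul1r.
rewrite GE; split; last by rewrite mulf_neq0.
split=> [x /f_pos fx_ge0|]; first by rewrite GE mulr_ge0 // ler0c.
rewrite GE; apply/eqP; rewrite eq_le; apply/andP; split.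
  apply/functional_norm_leP => x x1; rewrite normcM normc_real //.
  rewrite ler_pdivrMl // mulr1.
  by move/functional_norm_leP : f_ler; exact.
(* If [F] has norm [m], then [r * m] bounds [f] on the unit ball, so [r <= r * m] and hence
   [1 <= m]. *)
have := functional_norm_ge0 F.
case FE : (functional_norm F) => [m| |] //= _; rewrite ?leey // lee_fin.
rewrite -(ler_pM2l r_gt0) mulr1 -lee_fin -fE.
apply/functional_norm_leP => x x1.
have /functional_norm_leP/(_ x x1) : (functional_norm F <= m%:E)%E by rewrite FE.
by rewrite normcM normc_real // ler_pdivrMl.
Qed.

(** Division by [f a] keeps linearity, positivity and boundedness but may change the norm, so only
    some bound [c] is retained. *)
Lemma a_statesW (R : realType) (A : cstarAlgType R) (a : A) (g : A -> R[i]) :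
  positive a -> a_states a g ->
  exists f : {scalar A}, [/\ f = g :> (A -> R[i]), positive_functional f,
    f a = 1 & exists c : R, (functional_norm f <= c%:E)%E].
Proof.
move=> a_pos [f /= [[f_pos f1] fa_neq0] <-].
have [G GE] : exists G : {scalar A}, G = (fun x => f x / f a) :> (A -> R[i]).
  by apply: scalar_witness => k u v; rewrite linearP /= mulrDl mulrA.
exists G; rewrite GE; split=> //; last 2 first.
- by rewrite divff.
- exists (normc (f a)^-1); apply/functional_norm_leP => x x1.
  rewrite normcM ler_piMl ?normc_ge0 //.
  have /functional_norm_leP : (functional_norm f <= 1%:E)%E by rewrite f1.
  exact.
by move=> x /f_pos fx_ge0; rewrite mulr_ge0 // invr_ge0 f_pos.
Qed.

(** This is the source of new a-states: [star y * z * y] is positive with [z], and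
    submultiplicativity bounds the norm. *)
Lemma functional_compress (R : realType) (A : cstarAlgType R) (y : A)
    (f : {scalar A}) (c : R) :
  positive_functional f -> (functional_norm f <= c%:E)%E ->
  exists G : {scalar A}, [/\ G = (fun z => f (star y * z * y)) :> (A -> R[i]),
    positive_functional G & exists d : R, (functional_norm G <= d%:E)%E].
Proof.
move=> f_pos f_le.
have [G GE] : exists G : {scalar A},
    G = (fun z => f (star y * z * y)) :> (A -> R[i]).
  apply: scalar_witness => k u v.
  by rewrite mulrDr mulrDl -scalerAr -scalerAl linearP.
exists G; rewrite GE; split=> //.
  by move=> z z_pos; apply/f_pos/positive_sandwich.
exists (c * (cnorm (star y) * cnorm y)); apply/functional_norm_leP => z z1.
apply: (le_trans (normc_functional_le _ f_le)).
have c_ge0 : 0 <= c by rewrite -lee_fin (le_trans (functional_norm_ge0 f)).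
rewrite ler_wpM2l // (le_trans (cnormM _ _)) // ler_wpM2r ?cnorm_ge0 //.
by rewrite (le_trans (cnormM _ _)) // ler_piMr ?cnorm_ge0.
Qed.

(** * Cauchy-Schwarz and bounds by the numerical radius *)

Lemma quadratic_bound (R : realFieldType) (n p q : R) : 0 <= n -> 0 <= p ->
  (forall t, 0 <= q - 2 * t * n + t ^+ 2 * n * p) -> n <= p * q.
Proof.
move=> n0; rewrite le_eqVlt => /predU1P[<- H|p0 H].
  rewrite mul0r leNgt; apply/negP => n_gt0.
  (* For [p = 0] the expression is affine in [t], and this [t] gives it the value -1. *)
  have := H ((q + 1) / (2 * n)); rewrite mulr0 addr0.
  have -> : 2 * ((q + 1) / (2 * n)) * n = q + 1 by field; rewrite gt_eqF.
  by lra.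
(* The minimum over [t] when [n] is nonzero. *)
have := H p^-1.
have -> : q - 2 * p^-1 * n + p^-1 ^+ 2 * n * p = q - p^-1 * n.
  by field; rewrite gt_eqF.
by rewrite subr_ge0 ler_pdivrMl.
Qed.

Lemma cauchy_schwarz (R : realType) (A : cstarAlgType R) (a h : A)
    (f : {scalar A}) : positive a -> positive_functional f ->
  normc (f (a * h)) ^+ 2 <=
    complex.Re (f a) * complex.Re (f (star h * a * h)).
Proof.
move=> a_pos f_pos; apply: quadratic_bound; first by rewrite sqr_ge0.
  by move: (f_pos _ a_pos); rewrite lecE => /andP[].
(* The phase of [f (a * h)] in [d] makes the cross terms of [h + d] add up to [- 2 * t * n], where
   [n] is the squared modulus. *)
move=> t; pose d := - t%:C%C * f (a * h).
have := f_pos _ (positive_sandwich (h + d *: 1) a_pos).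
rewrite starD starZ star1 !(mulrDl, mulrDr) -!scalerAl -!scalerAr.
rewrite !mul1r !mulr1 scalerA !linearD /= !scalarZ /= lecE => /andP[_].
have -> : f (star h * a) = (f (a * h))^*%C.
  by rewrite -functional_star // starM (positive_star a_pos).
rewrite normc_sqr /d; have := ger0_Im (f_pos _ a_pos).
case: (f (a * h)) (f a) (f (star h * a * h)) => [u v] [u1 v1] [u2 v2] /= ->.
by lra.
Qed.

(** Homogeneous form of the bound on a-states, which also covers functionals vanishing at [a]: there
    Cauchy-Schwarz gives [f (a * z) = 0]. *)
Lemma a_states_bound (R : realType) (A : cstarAlgType R) (a z : A) (v c : R)
    (f : {scalar A}) :
  positive a -> positive_functional f -> (functional_norm f <= c%:E)%E ->
  (forall g, a_states a g -> normc (g (a * z)) <= v) ->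
  normc (f (a * z)) <= v * complex.Re (f a).
Proof.
move=> a_pos f_pos f_le z_le.
have [fa0|fa_neq0] := eqVneq (f a) 0.
  have := cauchy_schwarz z a_pos f_pos; rewrite fa0 /= mul0r mulr0.
  by rewrite -[X in _ <= X](expr0n R 2) ler_sqr ?nnegrE ?normc_ge0.
have := z_le _ (a_states_normalize f_pos f_le fa_neq0).
have := f_pos _ a_pos; rewrite lecE => /andP[/eqP fa_im fa_re].
have faE : f a = (complex.Re (f a))%:C%C.
  by case: (f a) fa_im => u w /= ->.
have fa_gt0 : 0 < complex.Re (f a).
  rewrite lt0r fa_re andbT; apply: contra fa_neq0 => /eqP fa0.
  by rewrite faE fa0.
by rewrite normcM normcV [in normc (f a)]faE normc_real // ler_pdivrMr.
Qed.

(* Polarization: for self-adjoint [K] on a semi-inner product space,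
   [4 Re <K x, y> = <K (x + y), x + y> - <K (x - y), x - y>], which is at most
   [2 v (<x, x> + <y, y>)]; take [x = 1] and [y = t k]. *)
Lemma a_selfadjoint_bound (R : realType) (A : cstarAlgType R) (a k : A)
    (v c : R) (f : {scalar A}) :
  positive a -> positive_functional f -> (functional_norm f <= c%:E)%E ->
  0 <= v -> is_a_adjoint a k k ->
  (forall g, a_states a g -> normc (g (a * k)) <= v) ->
  complex.Re (f (star k * a * k)) <= v ^+ 2 * complex.Re (f a).
Proof.
move=> a_pos f_pos f_le v_ge0 k_adj k_le.
have bound y : `|complex.Re (f (star y * (a * k) * y))| <=
    v * complex.Re (f (star y * a * y)).
  have [G [GE G_pos [d G_le]]] := functional_compress y f_pos f_le.
  have := a_states_bound a_pos G_pos G_le k_le; rewrite GE.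
  exact/le_trans/norm_Re_le.
have polar t : 4 * t * complex.Re (f (star k * a * k)) <=
    2 * v * (complex.Re (f a) + t ^+ 2 * complex.Re (f (star k * a * k))).
  have := bound (t%:C%C *: k + 1); have := bound (t%:C%C *: k - 1).
  have akk : a * k * k = star k * a * k by rewrite k_adj.
  rewrite !ler_norml !starD !starN !starZ star1 !conjc_real.
  rewrite !(mulrDl, mulrDr, mulrNN, mulNr, mulrN, mul1r, mulr1).
  rewrite -!(scalerAl, scalerAr) !scalerA !mulrA akk -k_adj.
  rewrite !(linearD, linearN) /= !scalarZ.
  case: (f (a * k * k * k)) (f (a * k * k)) (f (a * k)) (f a) =>
    [u1 w1] [u2 w2] [u3 w3] [u4 w4] /=.
  by move=> /andP[? ?] /andP[? ?]; lra.
(* For [v = 0], [t = 1] suffices. Otherwise [t = v^-1], after multiplication by [v], lets half of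
   the left side absorb the quadratic term. *)
have [v0|v_neq0] := eqVneq v 0; first by have := polar 1; rewrite v0; lra.
have v_gt0 : 0 < v by rewrite lt0r v_neq0.
have := polar v^-1; rewrite -(ler_pM2l v_gt0).
rewrite [leLHS](_ : _ = 4 * complex.Re (f (star k * a * k))); last by field.
rewrite [leRHS](_ : _ = 2 * v ^+ 2 * complex.Re (f a) +
  2 * complex.Re (f (star k * a * k))); last by field.
by lra.
Qed.

(** * Algebra of a-adjoints *)

Lemma is_a_adjoint_sym (R : realType) (A : cstarAlgType R) (a x y : A) :
  positive a -> is_a_adjoint a x y -> is_a_adjoint a y x.
Proof.
move=> a_pos xy; rewrite /is_a_adjoint -{2}(positive_star a_pos) -starM xy.
by rewrite starM starK (positive_star a_pos).
Qed.

Lemma is_a_adjointD (R : realType) (A : cstarAlgType R) (a x y x' y' : A) :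
  is_a_adjoint a x y -> is_a_adjoint a x' y' ->
  is_a_adjoint a (x + x') (y + y').
Proof. by rewrite /is_a_adjoint starD mulrDr mulrDl => -> ->. Qed.

Lemma is_a_adjointM (R : realType) (A : cstarAlgType R) (a x y x' y' : A) :
  is_a_adjoint a x y -> is_a_adjoint a x' y' -> is_a_adjoint a (x' * x) (y * y').
Proof. by rewrite /is_a_adjoint starM mulrA => -> xy; rewrite -mulrA xy mulrA. Qed.

Lemma is_a_adjointZ (R : realType) (A : cstarAlgType R) (a x y : A) (c : R[i]) :
  is_a_adjoint a x y -> is_a_adjoint a (c *: x) (c^*%C *: y).
Proof. by rewrite /is_a_adjoint starZ -scalerAr -scalerAl => ->. Qed.

Lemma functional_a_adjoint (R : realType) (A : cstarAlgType R) (a x y : A)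
    (f : {scalar A}) : positive a -> positive_functional f ->
  is_a_adjoint a x y -> f (a * y) = (f (a * x))^*%C.
Proof.
by move=> a_pos f_pos ->; rewrite -functional_star // starM (positive_star a_pos).
Qed.

(** * The fourth-power inequality for a single a-state *)

Lemma rotate_to_normc (R : rcfType) (z : R[i]) :
  exists2 u : R[i], u * u^*%C = 1 & u * z = (normc z)%:C%C.
Proof.
have [->|z_neq0] := eqVneq z 0.
  by exists 1; rewrite ?rmorph1 ?mulr1 // mulr0 normc0.
have n_neq0 : normc z != 0 by apply: contra z_neq0 => /eqP/eq0_normc/eqP.
have zz : z^*%C * z = (normc z ^+ 2)%:C%C.
  by rewrite normc_sqr; case: z {z_neq0 n_neq0} => x y; simpc; congr (_ +i* _)%C; ring.
exists ((normc z)^-1%:C%C * z^*%C); last first.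
  by rewrite -mulrA zz -rmorphM /= expr2 mulKf.
have -> : ((normc z)^-1%:C%C * z^*%C)^*%C = (normc z)^-1%:C%C * z.
  by rewrite (rmorphM conjc _ _ : (_ * _)^*%C = _^*%C * _^*%C) conjcK conjc_real.
rewrite mulrACA zz -!rmorphM /=.
by rewrite -invfM -expr2 mulVf ?expf_neq0.
Qed.

(* With [h = x + y], so that [f (a h) = 2 Re (f (a x))], applying
   Cauchy-Schwarz twice gives [(2 Re (f (a x))) ^ 4 <= f (a h ^ 4)], and
   [h ^ 2 = (x ^ 2 + y ^ 2) + (x y + y x)]. *)
Lemma fourth_power_bound (R : realType) (A : cstarAlgType R) (a x y : A)
    (f : {scalar A}) :
  positive a -> positive_functional f -> f a = 1 -> is_a_adjoint a x y ->
  let s := x * y + y * x in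
  let w := x ^+ 2 + y ^+ 2 in
  (16 * complex.Re (f (a * x)) ^+ 4 <=
    complex.Re (f (star w * a * w))
    + 2 * normc (f (a * (x ^+ 2 * s + s * x ^+ 2)))
    + Num.sqrt (complex.Re (f (star (s ^+ 2) * a * s ^+ 2))))%R.
Proof.
move=> a_pos f_pos fa1 xy; set s := _ + _; set w := _ + _; rewrite /=.
have yx := is_a_adjoint_sym a_pos xy.
have ss : is_a_adjoint a s s by apply: is_a_adjointD; exact: is_a_adjointM.
have xx : is_a_adjoint a (x ^+ 2) (y ^+ 2) by exact: is_a_adjointM.
have ww : is_a_adjoint a w w.
  rewrite {2}/w [_ + y ^+ 2]addrC; apply: is_a_adjointD => //.
  exact: is_a_adjoint_sym.
have zz : is_a_adjoint a (x ^+ 2 * s + s * x ^+ 2) (s * y ^+ 2 + y ^+ 2 * s).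
  by apply: is_a_adjointD; exact: is_a_adjointM.
have cs h : normc (f (a * h)) ^+ 2 <= complex.Re (f (star h * a * h)).
  by have := cauchy_schwarz h a_pos f_pos; rewrite fa1 mul1r.
have sqr_Re_le (z : R[i]) : complex.Re z ^+ 2 <= normc z ^+ 2.
  by rewrite normc_sqr lerDl sqr_ge0.
have hh : is_a_adjoint a (x + y) (x + y).
  by rewrite {2}[x + y]addrC; exact: is_a_adjointD.
have h2E : (x + y) ^+ 2 = w + s.
  rewrite expr2 mulrDl !mulrDr -!expr2 /w /s -!addrA; congr (_ + _).
  by rewrite addrA addrC.
(* The two groups are a-adjoint to each other, so [f (a * _)] takes conjugate values on them; this
   yields the factor 2. *)
have wsE : w * s + s * w =
    (x ^+ 2 * s + s * x ^+ 2) + (s * y ^+ 2 + y ^+ 2 * s).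
  by rewrite [w * s]mulrDl [s * w]mulrDr addrACA [y ^+ 2 * s + _]addrC.
have cs_h := cs (x + y); have cs_h2 := cs (w + s); have cs_s2 := cs (s ^+ 2).
have hahE : star (x + y) * a * (x + y) = a * (w + s).
  by rewrite -hh -mulrA -expr2 h2E.
have h2ah2E : star (w + s) * a * (w + s) =
    star w * a * w + (a * (x ^+ 2 * s + s * x ^+ 2) +
      a * (s * y ^+ 2 + y ^+ 2 * s)) + a * s ^+ 2.
  rewrite -(is_a_adjointD ww ss) -ww -[a * w * w]mulrA -[LHS]mulrA -!(mulrDr a).
  rewrite -wsE; congr (a * _).
  by rewrite [LHS]mulrDl [w * (w + s)]mulrDr [s * (w + s)]mulrDr !addrA.
rewrite hahE mulrDr linearD /= (functional_a_adjoint a_pos f_pos xy) in cs_h.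
rewrite h2ah2E !linearD /= (functional_a_adjoint a_pos f_pos zz) in cs_h2.
have {}cs_h : 4 * complex.Re (f (a * x)) ^+ 2 <= complex.Re (f (a * (w + s))).
  apply: le_trans (le_trans (sqr_Re_le _) cs_h).
  by case: (f (a * x)) => ? ? /=; lra.
have {}cs_h2 := le_trans (sqr_Re_le _) cs_h2.
have : (4 * complex.Re (f (a * x)) ^+ 2) ^+ 2 <=
    complex.Re (f (a * (w + s))) ^+ 2.
  have sqr_ge0' : 0 <= 4 * complex.Re (f (a * x)) ^+ 2.
    by rewrite mulr_ge0 ?sqr_ge0.
  by rewrite ler_sqr ?nnegrE // (le_trans sqr_ge0').
move=> /le_trans /(_ cs_h2).
(* A further Cauchy-Schwarz, with [f a = 1], brings in the integrand of the a-norm. *)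
have : complex.Re (f (a * s ^+ 2)) <=
    Num.sqrt (complex.Re (f (star (s ^+ 2) * a * s ^+ 2))).
  rewrite (le_trans (ler_norm _)) // (le_trans (norm_Re_le _)) //.
  by rewrite -(ger0_norm (normc_ge0 _)) -sqrtr_sqr ler_wsqrtr.
have := le_trans (ler_norm _) (norm_Re_le (f (a * (x ^+ 2 * s + s * x ^+ 2)))).
move: (Num.sqrt _) (normc _) => q n.
case: (f (a * (_ + _ * _))) (f (a * x)) (f (a * s ^+ 2)) (f (star w * a * w)) =>
  [u1 w1] [u2 w2] [u3 w3] [u4 w4] /=.
by lra.
Qed.

(** Replacing [x] and [xs] by [u *: x] and [u^* *: xs] with a unit [u] fixes [s] and multiplies
    [x ^+ 2] by a unit, so no modulus on the right changes, while [f (a * x)] becomes real and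
    nonnegative. *)
Lemma a_state_fourth_power_bound (R : realType) (A : cstarAlgType R)
    (a x xs : A) (g : A -> R[i]) (v : R) :
  positive a -> is_a_adjoint a x xs -> a_states a g -> 0 <= v ->
  (forall g', a_states a g' -> normc (g' (a * x ^+ 2)) <= v) ->
  forall s, s = x * xs + xs * x ->
  16 * normc (g (a * x)) ^+ 4 <=
    4 * v ^+ 2 + 2 * normc (g (a * (x ^+ 2 * s + s * x ^+ 2)))
    + Num.sqrt (complex.Re (g (star (s ^+ 2) * a * s ^+ 2))).
Proof.
move=> a_pos x_xs g_state v_ge0 v_le s sE.
have [f [<- f_pos fa1 [c f_le]]] := a_statesW a_pos g_state.
have [u uu u_rot] := rotate_to_normc (f (a * x)).
have nu : normc u = 1.
  have : normc u ^+ 2 = 1 by rewrite expr2 -{2}normcJ -normcM uu normc1.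
  by move=> /eqP; rewrite sqrf_eq1 => /orP[/eqP //|/eqP nuE];
    have := normc_ge0 u; rewrite nuE; lra.
have XY := is_a_adjointZ u x_xs; set X := u *: x in XY; set Y := _ *: xs in XY.
have sXY : X * Y + Y * X = s.
  by rewrite /X /Y -!(scalerAl, scalerAr) !scalerA [_^*%C * u]mulrC uu !scale1r.
have X2E : X ^+ 2 = u ^+ 2 *: x ^+ 2 by rewrite exprZn.
have YX := is_a_adjoint_sym a_pos XY.
have X2Y2 : is_a_adjoint a (X ^+ 2) (Y ^+ 2) by exact: is_a_adjointM.
have ww : is_a_adjoint a (X ^+ 2 + Y ^+ 2) (X ^+ 2 + Y ^+ 2).
  rewrite {2}[X ^+ 2 + _]addrC; apply: is_a_adjointD => //.
  exact: is_a_adjoint_sym.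
(* The values at [X ^+ 2] and [Y ^+ 2] are conjugate, whence [2 * v]; its square is the term
   [4 * v ^+ 2]. *)
have w_le h : a_states a h -> normc (h (a * (X ^+ 2 + Y ^+ 2))) <= 2 * v.
  move=> h_state; have := v_le _ h_state.
  have [k [<- k_pos _ _]] := a_statesW a_pos h_state => k_le.
  rewrite mulrDr linearD /= (functional_a_adjoint a_pos k_pos X2Y2).
  rewrite (le_trans (le_normcD _ _)) // normcJ X2E -scalerAr scalarZ normcM.
  by rewrite expr2 normcM nu !mul1r; lra.
have v2_ge0 : 0 <= 2 * v by rewrite mulr_ge0.
have := a_selfadjoint_bound a_pos f_pos f_le v2_ge0 ww w_le.
have := fourth_power_bound a_pos f_pos fa1 XY.
rewrite /= sXY {1}/X -scalerAr scalarZ u_rot X2E -scalerAl -scalerAr -scalerDr.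
rewrite -scalerAr scalarZ normcM [u ^+ 2]expr2 normcM nu !mul1r -expr2 fa1 /=.
by rewrite -X2E; lra.
Qed.

(** * Passage to suprema in [0, +oo] *)

Lemma nnsup_ge0 (R : realType) (E : set \bar R) : (0 <= nnsup E)%E.
Proof. by apply: ereal_sup_ubound; left. Qed.

Lemma nnsup_ubound (R : realType) (E : set \bar R) (e : \bar R) :
  E e -> (e <= nnsup E)%E.
Proof. by move=> Ee; apply: ereal_sup_ubound; right. Qed.

Lemma nnsup_le (R : realType) (E : set \bar R) (m : R) :
  0 <= m -> (forall e, E e -> (e <= m%:E)%E) -> (nnsup E <= m%:E)%E.
Proof.
by move=> m_ge0 Em; apply: ge_ereal_sup => e [->|/Em //]; rewrite lee_fin.
Qed.

(* [xs] ranges over all a-adjoints of [x]; its existence is the membership of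
   [x] in the algebra of a-adjointable elements. *)
Theorem theorem3p1 (R : realType) (A : cstarAlgType R) (a x xs : A)
    (a_neq0 : a != 0) (a_pos : positive a) (x_xs : is_a_adjoint a x xs) :
  let v := a_numerical_radius a in
  let s := x * xs + xs * x in
  (v x ^+ 4 <=
     (4^-1)%:E * v (x ^+ 2)%R ^+ 2
     + (8^-1)%:E * v (x ^+ 2 * s + s * x ^+ 2)%R
     + (16^-1)%:E * a_norm a (s ^+ 2)%R)%E.
Proof.
set v := a_numerical_radius a; set s := x * xs + xs * x; cbv zeta.
have v_ge0 y : (0 <= v y)%E by exact: nnsup_ge0.
have n_ge0 y : (0 <= a_norm a y)%E by exact: nnsup_ge0.
have v_le y g : a_states a g -> ((normc (g (a * y)%R))%:E <= v y)%E.
  by move=> g_state; apply: nnsup_ubound; exists g.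
have n_le y g : a_states a g ->
    ((Num.sqrt (complex.Re (g (star y * a * y)%R)))%:E <= a_norm a y)%E.
  by move=> g_state; apply: nnsup_ubound; exists g.
move: (v_ge0 (x ^+ 2)) (v_ge0 (x ^+ 2 * s + s * x ^+ 2)) (n_ge0 (s ^+ 2)).
move: (v_le (x ^+ 2)) (v_le (x ^+ 2 * s + s * x ^+ 2)) (n_le (s ^+ 2)).
case: (v (x ^+ 2)) => [p| |]; case: (v (x ^+ 2 * s + s * x ^+ 2)) => [q| |];
  case: (a_norm a (s ^+ 2)) => [r| |] //.
(* An infinite term makes the right side infinite, since all coefficients are positive. *)
all: try by rewrite expe2 ?mulyy ?gt0_muley ?lte_fin ?invr_gt0 //= ?leey.
move=> p_le q_le r_le; rewrite !lee_fin => p_ge0 q_ge0 r_ge0.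
rewrite -!EFin_expe -!EFinM -!EFinD.
set m := (_ + _)%R.
have m_ge0 : 0 <= m by rewrite !addr_ge0 ?mulr_ge0 ?invr_ge0 ?exprn_ge0.
(* Each a-state value is bounded by the fourth root of [m], so the supremum is too. Dividing the
   pointwise inequality by 16 gives the coefficients 1/4, 1/8 and 1/16. *)
have vx_le : (v x <= (Num.sqrt (Num.sqrt m))%:E)%E.
  apply: nnsup_le => [|_ [g g_state <-]]; first exact: sqrtr_ge0.
  rewrite lee_fin -ler_sqr ?nnegrE ?normc_ge0 ?sqrtr_ge0 //.
  rewrite sqr_sqrtr ?sqrtr_ge0 //.
  rewrite -ler_sqr ?nnegrE ?sqr_ge0 ?sqrtr_ge0 // sqr_sqrtr // -exprM.
  have := a_state_fourth_power_bound a_pos x_xs g_state p_ge0 p_le (erefl s).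
  have := q_le _ g_state; have := r_le _ g_state; rewrite !lee_fin /m.
  by lra.
have vx_ge0 := v_ge0 x.
case: (v x) vx_le vx_ge0 => [t| |] //.
rewrite lee_fin => t_le; rewrite lee_fin => t_ge0.
rewrite -EFin_expe lee_fin.
have -> : m = Num.sqrt (Num.sqrt m) ^+ 4.
  by rewrite (exprM _ 2 2) !sqr_sqrtr ?sqrtr_ge0.
by rewrite lerXn2r ?nnegrE ?sqrtr_ge0.
Qed.
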